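(* Let $n,\gamma,\beta$ be nonnegative integers with $\gamma+\beta\le n$, let $\tau>0$, and consider a linear lattice Boltzmann BGK scheme $$f_i(t+\Delta t,\mathbf x+\Delta t\,\mathbf c_i)=f_i(t,\mathbf x)+\frac1\tau\,\mathbf e_i^T\,(M^{(1)})^{-1}\left(E^{(1)}-I_n\right)M^{(1)}\,\mathbf f(t,\mathbf x),\qquad i=1,\dots,n,$$ with regular moment matrix $M^{(1)}\in\mathbb R^{n\times n}$ and equilibrium matrix $$E^{(1)}=\begin{pmatrix} I_\gamma&0&0\\ E^{(1)}_{21}&0&0\\ E^{(1)}_{31}&0&0\end{pmatrix}\in\mathbb R^{n\times n}$$ (block sizes $\gamma,\ \beta,\ n-\beta-\gamma$), which is consistent to $\alpha$-th order. Define $$M^{(2)}=\begin{pmatrix} I_\gamma&0&0\\ -E^{(1)}_{21}&I_\beta&0\\ -E^{(1)}_{31}&0&I_{n-\beta-\gamma}\end{pmatrix}M^{(1)},\qquad E^{(2)}=\begin{pmatrix} I_\gamma&0&0\\0&0&0\\0&0&0\end{pmatrix},$$ and let $\mathbf r^{(2)}_i$ denote the $i$-th row of $M^{(2)}$. Assume that $\Lambda^{(2)}\in\mathbb R^{n\times n}$ is a diagonal and positive definite matrix such that $$\mathbf r^{(2)}_i\,\Lambda^{(2)}\,(\mathbf r^{(2)}_j)^T=0\qquad\text{for all } i=1,\dots,\gamma,\ j=\gamma+1,\dots,n.$$ Then the collision matrix $$J^{(2)}=\frac1\tau\,(M^{(2)})^{-1}\left(E^{(2)}-I_n\right)M^{(2)}$$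 admits a pre-stability structure. If in addition $\tau\in\left[\tfrac12,\infty\right)$, then $J^{(2)}$ admits a stability structure.
   Context: Setting. $\mathbf f(t,\mathbf x)=(f_1,\dots,f_n)^T\in\mathbb R^n$ is the vector of particle densities on a periodic equidistant lattice in $\mathbb R^D$ with spacing $\Delta t$; the time step is also $\Delta t$. The discrete velocities $\mathbf c_1,\dots,\mathbf c_n\in\mathbb R^D$ map lattice nodes to lattice nodes ($\mathbf x\mapsto\mathbf x+\Delta t\,\mathbf c_i$), and the velocity set is symmetric under $\mathbf c\mapsto-\mathbf c$. $\mathbf e_i$ is the $i$-th standard basis vector and $I_m$ the $m\times m$ identity. The moment matrix $M^{(1)}$ maps $\mathbf f$ to moments: its first $\gamma$ rows give the conserved moments, the next $\beta$ rows give the moments whose equilibrium values are prescribed by consistency, and the remaining rows make it regular. The equilibrium matrix maps moments to equilibrium moments. Pre-stability structure. A matrix $J\in\mathbb R^{n\times n}$ has (admits) a pre-stability structure $(P,\mathbf a,\mathbf s)$ if there exist an invertible $P\in\mathbb R^{n\times n}$ and vectors $\mathbf s=(s_1,\dots,s_n)^T$, $\mathbf a=(a_1,\dots,a_n)^T\in\mathbb R^n$ such that $PJ=-\operatorname{diag}(s_1,\dots,s_n)P$ and $P^TP=\operatorname{diag}(a_1,\dots,a_n)$. It is a stability structure if moreover $s_k\in[0,2]$ for all $k$. Consistency. The scheme is consistent to $\alpha$-th order with a given linear system of partial differential equations for its conserved moments if, for formal expansions $\mathbf f=\sum_{k\ge0}\Delta t^k\mathbf f^{(k)}$ (smooth coefficients)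 inserted in the scheme, Taylor expanded about $(t,\mathbf x)$ and sorted by powers of $\Delta t$, the conserved moments of $\mathbf f^{(0)},\dots,\mathbf f^{(\alpha-1)}$ each satisfy that system. *)

(* Defs.v *)
From HB Require Import structures.
From mathcomp Require Export all_boot all_order all_algebra.
From mathcomp Require Export all_classical all_reals all_analysis.

Set Implicit Arguments.
Unset Strict Implicit.
Unset Printing Implicit Defensive.

Export Order.TTheory GRing.Theory Num.Theory.
Export numFieldNormedType.Exports.

Local Open Scope classical_set_scope.
Local Open Scope ring_scope.

Section LatticeBoltzmann.
Variables (R : realType) (D : nat).

(* A space-time point is a pair (t, x); functions of (t, x) are considered for
   t > 0 only, so what they do for t <= 0 is irrelevant. *)
Notation point := (R * 'rV[R]_D)%type.

Definition lattice (dt : R) : set 'rV[R]_D :=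
  [set x | exists z : 'rV[int]_D, x = dt *: map_mx intr z].

(* The spatial domain is the box with side lengths [L 0 d], opposite faces
   being identified; the side lengths fit the lattice. *)
Definition period (L : 'rV[R]_D) (d : 'I_D) : 'rV[R]_D :=
  L 0 d *: delta_mx 0 d.

Definition lattice_box (dt : R) (L : 'rV[R]_D) : Prop :=
  forall d, 0 < L 0 d /\ lattice dt (period L d).

Definition space_periodic (W : Type) (L : 'rV[R]_D) (g : point -> W) : Prop :=
  forall t x d, g (t, x + period L d) = g (t, x).

Definition lattice_velocities n (dt : R) (c : 'I_n -> 'rV[R]_D) : Prop :=
  forall i x, lattice dt x -> lattice dt (x + dt *: c i).

Definition symmetric_velocities n (c : 'I_n -> 'rV[R]_D) : Prop :=
  forall i, exists j, c j = - c i.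

Definition collision_matrix n (tau : R) (M E : 'M[R]_n) : 'M[R]_n :=
  tau^-1 *: (invmx M *m (E - 1%:M) *m M).

Definition lb_residual n (J : 'M[R]_n) (c : 'I_n -> 'rV[R]_D) (dt : R)
    (f : point -> 'cV[R]_n) (p : point) (i : 'I_n) : R :=
  f (p.1 + dt, p.2 + dt *: c i) i 0 - (f p i 0 + (J *m f p) i 0).

(* [None] is the time direction, [Some d] the [d]-th coordinate direction. *)
Definition direction (e : option 'I_D) : point :=
  if e is Some d then (0, delta_mx 0 d) else (1, 0).

Definition partials (W : normedModType R) (w : seq (option 'I_D))
    (g : point -> W) : point -> W :=
  foldr (fun e h p => 'D_(direction e) h p) g w.

(* C^infinity for t > 0: all iterated partial derivatives are (Frechet)
   differentiable. *)
Definition smooth (W : normedModType R) (g : point -> W) : Prop :=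
  forall (w : seq (option 'I_D)) (p : point),
    0 < p.1 -> differentiable (partials w g) p.

(* [q] linear equations for [m] unknown functions:
   \sum_(T <- pde_terms) T.1 * (partial derivative T.2 of the unknowns)
   = pde_rhs.  Coefficients and right-hand side may depend on (t, x). *)
Record linear_pde (q m : nat) := LinearPDE {
  pde_terms : seq ((point -> 'M[R]_(q, m)) * seq (option 'I_D));
  pde_rhs : point -> 'cV[R]_q }.

Definition pde_solution q m (S : linear_pde q m) (u : point -> 'cV[R]_m) :
    Prop :=
  forall p : point, 0 < p.1 ->
    \sum_(T <- pde_terms S) T.1 p *m partials T.2 u p = pde_rhs S p.

Definition partial_expansion n (f : nat -> point -> 'cV[R]_n) (N : nat)
    (h : R) (p : point) : 'cV[R]_n :=
  \sum_(k < N.+1) h ^+ k *: f k p.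

(* Coefficient of dt^N after the expansion \sum_k dt^k f_k is inserted in the
   scheme and Taylor expanded about p = (t, x).  Terms with k > N contribute
   O(dt^(N+1)) only, so they are left out. *)
Definition residual_coef n (J : 'M[R]_n) (c : 'I_n -> 'rV[R]_D)
    (f : nat -> point -> 'cV[R]_n) (N : nat) (p : point) (i : 'I_n) : R :=
  derive1n N (fun h : R => lb_residual J c h (partial_expansion f N h) p i) 0
  / N`!%:R.

Definition formal_solution n (J : 'M[R]_n) (c : 'I_n -> 'rV[R]_D)
    (L : 'rV[R]_D) (f : nat -> point -> 'cV[R]_n) : Prop :=
  (forall k, smooth (f k) /\ space_periodic L (f k)) /\
  (forall N (p : point) i, 0 < p.1 -> residual_coef J c f N p i = 0).

(* The conserved moments are given by the first [g] rows of [M]. *)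
Definition consistent g l q (alpha : nat) (J M : 'M[R]_(g + l))
    (c : 'I_(g + l) -> 'rV[R]_D) (L : 'rV[R]_D) (S : linear_pde q g) : Prop :=
  forall f : nat -> point -> 'cV[R]_(g + l),
    formal_solution J c L f ->
    forall k, (k < alpha)%N -> pde_solution S (fun p => usubmx (M *m f k p)).

End LatticeBoltzmann.

Section StabilityStructure.
Variables (R : realType) (n : nat).

Definition posdef (A : 'M[R]_n) : Prop :=
  A^T = A /\ forall x : 'cV[R]_n, x != 0 -> 0 < (x^T *m A *m x) 0 0.

Definition pre_stability_structure (J P : 'M[R]_n) (a s : 'rV[R]_n) : Prop :=
  [/\ P \in unitmx, P *m J = - diag_mx s *m P & P^T *m P = diag_mx a].

Definition stability_structure (J P : 'M[R]_n) (a s : 'rV[R]_n) : Prop :=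
  pre_stability_structure J P a s /\ forall k, 0 <= s 0 k <= 2.

End StabilityStructure.

Section Moments.
(* Block sizes gamma, beta and n - beta - gamma are g, b and l. *)
Variables (R : realType) (g b l : nat).

Definition equilibrium1 (E21 : 'M[R]_(b, g)) (E31 : 'M[R]_(l, g)) :
    'M[R]_(g + (b + l)) :=
  block_mx 1%:M 0 (col_mx E21 E31) 0.

Definition equilibrium2 : 'M[R]_(g + (b + l)) := block_mx 1%:M 0 0 0.

Definition moment2 (E21 : 'M[R]_(b, g)) (E31 : 'M[R]_(l, g))
    (M1 : 'M[R]_(g + (b + l))) : 'M[R]_(g + (b + l)) :=
  block_mx 1%:M 0 (col_mx (- E21) (- E31)) (block_mx 1%:M 0 0 1%:M) *m M1.

End Moments.
Arguments equilibrium2 : clear implicits.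

(* Main.v *)
(** The rows of [M2] split into two families that are orthogonal for the inner
    product [Lambda], so the Gram matrix [M2 Lambda M2^T] is block diagonal and
    positive definite.  Orthonormalising each family separately by a block
    diagonal [Q] gives [P = Q M2] with [P Lambda P^T = 1], that is
    [P^T P = Lambda^-1], which is diagonal; and since [Q] commutes with [E2 - 1],
    [P] still diagonalises [J2], with eigenvalues [0] and [- tau^-1]. *)
Require Import Defs.
From mathcomp Require Import ring.
Local Open Scope ring_scope.

Set Implicit Arguments.
Unset Strict Implicit.

(** Left multiplication by a diagonal [A] scales row [k] by [A k k]. In [A *m invmx A = 1] the
    diagonal entries force [A i i != 0], and then the off-diagonal entries of the inverse vanish. *)
Lemma is_diag_invmx (F : fieldType) n (A : 'M[F]_n) :
  A \in unitmx -> is_diag_mx A -> is_diag_mx (invmx A).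
Proof.
move=> Au /is_diag_mxP dA; apply/is_diag_mxP => i j ij.
have Aii k l : (A *m invmx A) k l = A k k * invmx A k l.
  rewrite mxE (bigD1 k) //= big1 ?addr0 // => m mk.
  by rewrite dA ?mul0r // eq_sym.
have Aii0 : A i i != 0.
  apply/eqP => e; have := Aii i i; rewrite mulmxV // mxE eqxx e mul0r.
  by move/eqP; rewrite oner_eq0.
have := Aii i j; rewrite mulmxV // mxE -val_eqE (negbTE ij) => /esym/eqP.
by rewrite mulf_eq0 (negbTE Aii0) => /eqP.
Qed.

Section PositiveDefinite.
Variable R : realType.

Lemma posdef_congr n (A B : 'M[R]_n) :
  B \in unitmx -> posdef A -> posdef (B *m A *m B^T).
Proof.
move=> Bu [sA pA]; split; first by rewrite !trmx_mul trmxK sA mulmxA.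
move=> x x0; have BTx0 : B^T *m x != 0.
  have BTu : B^T \in unitmx by rewrite unitmx_tr.
  by apply: contra x0 => /eqP e; rewrite -(mulKmx BTu x) e mulmx0.
by have := pA _ BTx0; rewrite trmx_mul trmxK !mulmxA.
Qed.

Lemma posdef_ulsubmx m n (A : 'M[R]_(m + n)) : posdef A -> posdef (ulsubmx A).
Proof.
move=> [sA pA]; split; first by rewrite trmx_ulsub sA.
move=> x x0; have : col_mx x (0 : 'cV_n) != 0.
  by rewrite col_mx_eq0 negb_and x0.
move=> /pA; rewrite -{1}(submxK A) tr_col_mx mul_row_block mul_row_col.
by rewrite trmx0 !mul0mx !addr0 mulmx0 addr0.
Qed.

Lemma posdef_drsubmx m n (A : 'M[R]_(m + n)) : posdef A -> posdef (drsubmx A).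
Proof.
move=> [sA pA]; split; first by rewrite trmx_drsub sA.
move=> x x0; have : col_mx (0 : 'cV_m) x != 0.
  by rewrite col_mx_eq0 negb_and x0 orbT.
move=> /pA; rewrite -{1}(submxK A) tr_col_mx mul_row_block mul_row_col.
by rewrite trmx0 !mul0mx !add0r mulmx0 add0r.
Qed.

Lemma posdef_scalar_gt0 (a : R) : @posdef R 1 a%:M -> 0 < a.
Proof.
case=> _ /(_ 1%:M (matrix_nonzero1 _ _)).
by rewrite trmx1 mul1mx mulmx1 mxE eqxx mulr1n.
Qed.

(** Cholesky factorisation in inverse form, by symmetric Gaussian elimination: clear the first row
    and column with the positive pivot [a], then recurse on the Schur complement, which is again
    positive definite. *)
Lemma posdef_congr1 n (A : 'M[R]_n) :
  posdef A -> exists Q : 'M[R]_n, Q *m A *m Q^T = 1%:M.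
Proof.
elim: n A => [|n IHn] A pA.
  by exists 1%:M; apply/matrixP; case.
rewrite -[n.+1]/(1 + n)%N in A pA *.
pose a := ulsubmx A 0 0.
have aE : ulsubmx A = a%:M by rewrite -mx11_scalar.
have a_gt0 : 0 < a.
  by apply: posdef_scalar_gt0; rewrite -aE; apply: posdef_ulsubmx.
(* [B = E A E^T] is the direct sum of [a] and its Schur complement in [A]. *)
pose E : 'M[R]_(1 + n) := block_mx 1%:M 0 (- (a^-1 *: dlsubmx A)) 1%:M.
have Eu : E \in unitmx by rewrite unitmxE det_lblock !det1 mulr1 unitr1.
have pS := posdef_congr Eu pA.
set B := E *m A *m E^T in pS.
have EA : E *m A = block_mx a%:M (ursubmx A) 0
    (drsubmx A - a^-1 *: dlsubmx A *m ursubmx A).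
  rewrite -{1}(submxK A) /E mulmx_block !mul1mx !mul0mx !addr0 aE.
  congr block_mx; last by rewrite mulNmx addrC.
  by rewrite mulNmx mul_mx_scalar scalerA divff ?gt_eqF // scale1r addNr.
(* [E^T] is block upper unitriangular, so right multiplication by it keeps the first block column of
   [E *m A]. *)
have ulB : ulsubmx B = a%:M.
  rewrite /B EA /E tr_block_mx mulmx_block block_mxKul.
  by rewrite !trmx0 trmx1 mulmx1 mulmx0 addr0.
have dlB : dlsubmx B = 0.
  rewrite /B EA /E tr_block_mx mulmx_block block_mxKdl.
  by rewrite !trmx0 mul0mx mulmx0 addr0.
have urB : ursubmx B = 0.
  by apply: trmx_inj; rewrite trmx_ursub (proj1 pS) dlB trmx0.
have [Q0 hQ0] := IHn _ (posdef_drsubmx pS).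
(* [r] normalises the pivot, [r * a * r = 1], while [Q0] normalises the Schur complement. *)
pose r := (Num.sqrt a)^-1.
exists (block_mx r%:M 0 0 Q0 *m E).
rewrite trmx_mul !mulmxA.
rewrite -(mulmxA (block_mx _ _ _ _)) -(mulmxA (block_mx _ _ _ _)).
rewrite -/B -(submxK B) ulB dlB urB tr_block_mx !mulmx_block.
rewrite !trmx0 !(mul0mx, mulmx0, addr0, add0r) hQ0 tr_scalar_mx -!scalar_mxM.
rewrite (_ : r * a * r = 1) -?scalar_mx_block //.
by rewrite -{1}(sqr_sqrtr (ltW a_gt0)) /r; field; rewrite gt_eqF // sqrtr_gt0.
Qed.

(** In [Q *m (A *m Q^T) = 1] the second factor is invertible, hence so is [A]. *)
Lemma posdef_unitmx n (A : 'M[R]_n) : posdef A -> A \in unitmx.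
Proof.
move=> /posdef_congr1[Q]; rewrite -mulmxA => hQ.
have [Qu] := mulmx1_unit hQ.
by rewrite unitmx_mul => /andP[].
Qed.

End PositiveDefinite.

(** The factor in front of [M1] is block lower unitriangular, so its determinant is 1. *)
Lemma moment2_unitmx (R : realType) (g b l : nat) (E21 : 'M[R]_(b, g))
    (E31 : 'M[R]_(l, g)) (M1 : 'M[R]_(g + (b + l))) :
  M1 \in unitmx -> moment2 E21 E31 M1 \in unitmx.
Proof.
move=> M1u; rewrite unitmx_mul M1u andbT -(@scalar_mx_block _ b l).
by rewrite unitmxE det_lblock !det1 mulr1 unitr1.
Qed.

Lemma pre_stability_of_orthogonal_rows (R : realType) (g b l : nat) (tau : R)
    (M Lambda : 'M[R]_(g + (b + l))) :
  M \in unitmx -> is_diag_mx Lambda -> posdef Lambda ->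
  ursubmx (M *m Lambda *m M^T) = 0 ->
  exists P a, pre_stability_structure
    (collision_matrix tau M (equilibrium2 R g b l)) P a
    (row_mx 0 (const_mx tau^-1)).
Proof.
move=> Mu dL pL; set G := M *m Lambda *m M^T => urG.
have pG : posdef G by apply: posdef_congr.
have dlG : dlsubmx G = 0.
  by apply: trmx_inj; rewrite trmx_dlsub (proj1 pG) urG trmx0.
have [Q1 hQ1] := posdef_congr1 (posdef_ulsubmx pG).
have [Q2 hQ2] := posdef_congr1 (posdef_drsubmx pG).
pose Q : 'M[R]_(g + (b + l)) := block_mx Q1 0 0 Q2.
pose P := Q *m M.
have PLP : P *m (Lambda *m P^T) = 1%:M.
  rewrite /P trmx_mul !mulmxA -(mulmxA Q) -(mulmxA Q) -/G -(submxK G) urG dlG.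
  rewrite tr_block_mx !mulmx_block !trmx0 !(mul0mx, mulmx0, addr0, add0r).
  by rewrite hQ1 hQ2 -scalar_mx_block.
have [Pu _] := mulmx1_unit PLP.
have Lu := posdef_unitmx pL.
(* A one-sided inverse of a square matrix is two-sided, so [PLP] also gives
   [Lambda *m P^T *m P = 1]. *)
have PTP : P^T *m P = invmx Lambda.
  by rewrite -(mulKmx Lu (P^T *m P)) (mulmxA Lambda) (mulmx1C PLP) mulmx1.
have /diag_mxP[a ha] : is_diag_mx (invmx Lambda) by exact: is_diag_invmx.
exists P, a; split => //; last by rewrite PTP.
(* After [M *m invmx M] cancels, both sides end in the factor [M]. It remains to compare
   [tau^-1 *: (Q *m (E2 - 1))] with [- diag_mx s *m Q]; both are zero except for the lower right
   block [- tau^-1 *: Q2]. *)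
rewrite /collision_matrix -scalemxAr !mulmxA /P mulmxK //.
rewrite (@scalar_mx_block _ g (b + l)) /equilibrium2 opp_block_mx add_block_mx.
rewrite diag_mx_row !diag_const_mx scalemxAl; congr (_ *m _).
rewrite /Q opp_block_mx !mulmx_block scale_block_mx.
rewrite !(subrr, oppr0, add0r, addr0, mul0mx, mulmx0, scaler0).
by rewrite mulmxN mulmx1 !mulNmx !mul_scalar_mx scale0r oppr0 scalerN.
Qed.

Theorem theorem6 (R : realType) (D gamma beta delta : nat)
  (tau : R) (htau : 0 < tau)
  (dt : R) (hdt : 0 < dt) (L : 'rV[R]_D) (hL : lattice_box dt L)
  (c : 'I_(gamma + (beta + delta)) -> 'rV[R]_D)
  (hc : lattice_velocities dt c) (hcsym : symmetric_velocities c)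
  (M1 : 'M[R]_(gamma + (beta + delta))) (hM1 : M1 \in unitmx)
  (E21 : 'M[R]_(beta, gamma)) (E31 : 'M[R]_(delta, gamma))
  (q : nat) (pde : linear_pde R D q gamma) (alpha : nat)
  (hcons : consistent alpha
     (collision_matrix tau M1 (equilibrium1 E21 E31)) M1 c L pde)
  (Lambda : 'M[R]_(gamma + (beta + delta)))
  (hLdiag : is_diag_mx Lambda) (hLpos : posdef Lambda)
  (horth : forall (i : 'I_gamma) (j : 'I_(beta + delta)),
     row (lshift (beta + delta) i) (moment2 E21 E31 M1) *m Lambda
       *m (row (rshift gamma j) (moment2 E21 E31 M1))^T = 0) :
  let J2 := collision_matrix tau (moment2 E21 E31 M1)
              (equilibrium2 R gamma beta delta) in
  (exists P a s, pre_stability_structure J2 P a s) /\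
  (2^-1 <= tau -> exists P a s, stability_structure J2 P a s).
Proof.
set M := moment2 E21 E31 M1 in horth *; move=> J2.
have Mu : M \in unitmx by apply: moment2_unitmx.
have urG : ursubmx (M *m Lambda *m M^T) = 0.
  (* The single entry of the 1 x 1 product in [horth i j] is the entry [(i, j)] of the upper right
     block. *)
  apply/matrixP => i j; have /matrixP/(_ 0 0) := horth i j.
  rewrite -row_mul !mxE; apply: etrans.
  by apply: eq_bigr => k _; rewrite !mxE.
have [P [a hP]] := pre_stability_of_orthogonal_rows tau Mu hLdiag hLpos urG.
split; first by exists P, a, (row_mx 0 (const_mx tau^-1)).
move=> tau_ge; exists P, a, (row_mx 0 (const_mx tau^-1)); split => // k.
rewrite mxE; case: splitP => j _; rewrite mxE; first by rewrite lexx ler0n.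
(* Writing 2 as the inverse of [2^-1] turns [tau^-1 <= 2] into [2^-1 <= tau], as inversion is
   antitone on positive numbers. *)
by rewrite invr_ge0 ltW //= -[2]invrK lef_pV2 ?posrE ?invr_gt0.
Qed.
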